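(* Consider a three-node branch with real nonzero true parameters satisfying $a_{21}^0=a_{32}^0$, with excitation variances $\sigma_1^2,\sigma_2^2>0$ and measurement noise variances $\lambda_2,\lambda_3>0$. Let $P^{\mathrm{I}}$ and $P^{\mathrm{II}}$ be the asymptotic covariance matrices of the estimates of $(a_{21},a_{32})$ under the excitation and measurement patterns (I) $\mathcal B=\{1,2\},\ \mathcal C=\{3\}$ and (II) $\mathcal B=\{1\},\ \mathcal C=\{2,3\}$, respectively. Then $\mathrm{tr}(P^{\mathrm{I}})=\mathrm{tr}(P^{\mathrm{II}})$ when $\sigma_2^2=(\lambda_3/\lambda_2)\sigma_1^2$; if $\sigma_2^2/\lambda_3>\sigma_1^2/\lambda_2$ then $\mathrm{tr}(P^{\mathrm{I}})<\mathrm{tr}(P^{\mathrm{II}})$ (it is better to excite node 2 than to measure it); and if $\sigma_2^2/\lambda_3<\sigma_1^2/\lambda_2$ then $\mathrm{tr}(P^{\mathrm{I}})>\mathrm{tr}(P^{\mathrm{II}})$.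
   Context: A dynamic network with $n$ nodes is $w(t)=G^0(q)w(t)+Br(t)$, $y(t)=Cw(t)+e(t)$, $t\in\mathbb Z$, where $q$ is the forward shift operator ($qr(t)=r(t+1)$), $w(t)\in\mathbb R^n$ are the node signals, $r$ the external excitations, $y$ the measured outputs, $e$ the measurement noise. $B$ and $C$ are binary selection matrices; $\mathcal B$ is the set of nodes $i$ to which an external signal $r_i$ is applied, and $\mathcal C$ is the set of nodes $j$ that are measured, $y_j=w_j+e_j$. The pair $(\mathcal B,\mathcal C)$ is called an excitation and measurement pattern (EMP). The three-node branch has $G^0(q)=q^{-1}A^0$ where the only nonzero entries of $A^0\in\mathbb R^{3\times 3}$ are $a_{21}^0$ and $a_{32}^0$, i.e. $w_1(t)=r_1(t)$, $w_2(t)=a_{21}^0w_1(t-1)+r_2(t)$, $w_3(t)=a_{32}^0w_2(t-1)+r_3(t)$, with $r_i\equiv0$ if $i\notin\mathcal B$. Assumptions: the $r_i$, $i\in\mathcal B$, are mutually independent stationary zero-mean white noise processes with variances $\sigma_i^2>0$, uncorrelated with the noises; the $e_j$, $j\in\mathcal C$, are independent stationary Gaussian zero-mean white noise processes with variances $\lambda_j>0$. For a parameter vector $\theta=(a_{21},a_{32})$ (estimated as two independent parameters), let $G(q,\theta)$ be the network matrix with $a_{ij}$ in place of $a_{ij}^0$. The optimal one-step-ahead predictor is $\hat y(t|t-1;\theta)=C(I-G(q,\theta))^{-1}Br(t)$. Let $\psi(t)$ be the $2\times|\mathcal C|$ matrix whose entry in the row of parameter $\theta_k$ and column of output $j\in\mathcal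 C$ is $\partial \hat y_j(t|t-1;\theta)/\partial\theta_k$ evaluated at the true parameter, and $\Lambda=\mathrm{diag}(\lambda_j)_{j\in\mathcal C}$. The asymptotic covariance matrix of the EMP is $P=[\mathbb E\,\psi(t)\Lambda^{-1}\psi(t)^T]^{-1}$. *)

(* Defs.v *)
From HB Require Import structures.
From mathcomp Require Import all_boot all_order all_algebra.
From mathcomp Require Import all_classical all_reals all_analysis.
Import Order.TTheory GRing.Theory Num.Theory.
Import numFieldNormedType.Exports.

Set Implicit Arguments.
Unset Strict Implicit.
Unset Printing Implicit Defensive.

Local Open Scope classical_set_scope.
Local Open Scope ring_scope.

Section Transfer.
Context {R : realType}.

(* Transfer functions are polynomials in the delay q^-1: the indeterminate 'X
   of {poly R} stands for q^-1, so the coefficient of 'X^k multiplies the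
   signal delayed by k.  The entries of (I - G)^-1 remain of this form whenever
   I - G is invertible over {poly R}, as it is for an acyclic network. *)
Definition transfer m n (H : 'M[{poly R}]_(m, n)) (u : int -> 'cV[R]_n) (t : int)
    : 'cV[R]_m :=
  \col_i \sum_j \sum_(k < size (H i j)) (H i j)`_k * u (t - k%:Z) j 0.

(* The columns of [excitation_mx B] are the unit vectors e_i, i in B, and the
   rows of [measurement_mx C] are the e_j^T, j in C, in increasing order. *)
Definition excitation_mx n (B : {set 'I_n}) : 'M[R]_(n, #|B|) :=
  \matrix_(i, k) (i == enum_val k)%:R.

Definition measurement_mx n (C : {set 'I_n}) : 'M[R]_(#|C|, n) :=
  \matrix_(k, j) (j == enum_val k)%:R.

End Transfer.

Section Processes.
Context {d : measure_display} {T : measurableType d} {R : realType}.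
Variable P : probability T R.

(* Weak (second-order) stationarity. *)
Definition stationary (X : int -> {RV P >-> R}) : Prop :=
  [/\ forall t, (X t : T -> R) \in Lfun P 2%:E,
      forall t u, ('E_P[X t] = 'E_P[X u])%E &
      forall t u h, covariance P (X (t + h)) (X (u + h)) =
                    covariance P (X t) (X u)].

Definition white_noise (X : int -> {RV P >-> R}) (v : R) : Prop :=
  [/\ stationary X,
      forall t, ('E_P[X t] = 0)%E,
      forall t, 'V_P[X t] = v%:E &
      forall t u, t != u -> covariance P (X t) (X u) = 0%E].

(* The sigma-algebra generated by the whole process. *)
Definition process_sigma (X : int -> {RV P >-> R}) : set (set T) :=
  <<s [set F | exists t, exists2 V, measurable V & F = X t @^-1` V] >>.

(* Taking F i = setT for some of the i gives the product rule for every
   subfamily. *)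
Definition independent_processes n (A : {set 'I_n})
    (X : 'I_n -> int -> {RV P >-> R}) : Prop :=
  forall F : 'I_n -> set T,
    (forall i, i \in A -> process_sigma (X i) (F i)) ->
    P (\bigcap_(i in [set` A]) F i) = (\prod_(i in A) P (F i))%E.

(* The point masses are the degenerate Gaussian laws; they are separate since
   [normal_prob m 0] is not a point mass. *)
Definition gaussian_variable (f : T -> R) : Prop :=
  (exists m s : R, s != 0 /\
     forall V, measurable V -> P (f @^-1` V) = normal_prob m s V) \/
  (exists m : R, forall V, measurable V -> P (f @^-1` V) = \d_m V).

Definition gaussian_process (X : int -> {RV P >-> R}) : Prop :=
  forall (k : nat) (c : 'I_k -> R) (s : 'I_k -> int),
    gaussian_variable (fun x => \sum_i c i * X (s i) x).

End Processes.

Section Networks.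
Context {d : measure_display} {T : measurableType d} {R : realType}.
Context {P : probability T R} {n : nat}.

(* Excitations and noises are indexed by all the nodes for convenience; only
   [exc i] for i in B and [noise j] for j in C are ever used. *)
Record signals (C : {set 'I_n}) := Signals {
  exc : 'I_n -> int -> {RV P >-> R};
  noise : 'I_n -> int -> {RV P >-> R};
  node : int -> T -> 'cV[R]_n;
  output : int -> T -> 'cV[R]_#|C| }.

Variables B C : {set 'I_n}.

Definition exc_vec (r : 'I_n -> int -> {RV P >-> R}) (t : int) (x : T)
    : 'cV[R]_#|B| := \col_k r (enum_val k) t x.

Definition noise_vec (e : 'I_n -> int -> {RV P >-> R}) (t : int) (x : T)
    : 'cV[R]_#|C| := \col_k e (enum_val k) t x.

Definition dynamic_network (G0 : 'M[{poly R}]_n) (D : signals C) : Prop :=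
  forall t x,
    node D t x = transfer G0 (fun u => node D u x) t
                 + excitation_mx B *m exc_vec (exc D) t x /\
    output D t x = measurement_mx C *m node D t x + noise_vec (noise D) t x.

Definition signal_assumptions (sigma lambda : 'I_n -> R) (D : signals C)
    : Prop :=
  [/\ forall i, i \in B -> white_noise (exc D i) (sigma i ^+ 2),
      independent_processes B (exc D),
      forall j, j \in C ->
        gaussian_process (noise D j) /\ white_noise (noise D j) (lambda j),
      independent_processes C (noise D) &
      forall i j t u, i \in B -> j \in C ->
        covariance P (exc D i t) (noise D j u) = 0%E].

Variables (p : nat) (G : 'rV[R]_p -> 'M[{poly R}]_n).

Definition predictor (D : signals C) (t : int) (x : T) (theta : 'rV[R]_p)
    : 'cV[R]_#|C| :=
  transfer (map_mx polyC (measurement_mx C) *m invmx (1%:M - G theta)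
          *m map_mx polyC (excitation_mx B))
    (fun u => exc_vec (exc D) u x) t.

Definition psi (theta0 : 'rV[R]_p) (D : signals C) (t : int) (x : T)
    : 'M[R]_(p, #|C|) :=
  \matrix_(k, j)
    'D_(delta_mx 0 k) (fun theta : 'rV[R]_p => predictor D t x theta j 0)
      theta0.

Definition Lambda (lambda : 'I_n -> R) : 'M[R]_#|C| :=
  diag_mx (\row_j lambda (enum_val j)).

Definition information_mx (lambda : 'I_n -> R) (theta0 : 'rV[R]_p)
    (D : signals C) (t : int) : 'M[R]_p :=
  \matrix_(k, l) fine ('E_P[fun x : T =>
    (psi theta0 D t x *m invmx (Lambda lambda) *m (psi theta0 D t x)^T) k l])%E.

Definition asymptotic_cov (lambda : 'I_n -> R) (theta0 : 'rV[R]_p)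
    (D : signals C) (t : int) : 'M[R]_p :=
  invmx (information_mx lambda theta0 D t).

End Networks.

Arguments signals {d T R} P {n} C.

Definition node1 : 'I_3 := @Ordinal 3 0 isT.
Definition node2 : 'I_3 := @Ordinal 3 1 isT.
Definition node3 : 'I_3 := @Ordinal 3 2 isT.

Section Branch.
Context {R : realType}.

Definition branch_param (a21 a32 : R) : 'rV[R]_2 :=
  \row_k (if k == 0 then a21 else a32).

Definition branch_coef (theta : 'rV[R]_2) : 'M[R]_3 :=
  theta 0 0 *: delta_mx node2 node1 + theta 0 1 *: delta_mx node3 node2.

(* G(q, theta) = q^-1 A(theta) *)
Definition branch (theta : 'rV[R]_2) : 'M[{poly R}]_3 :=
  'X *: map_mx polyC (branch_coef theta).

End Branch.

Definition B_I : {set 'I_3} := [set node1; node2].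
Definition C_I : {set 'I_3} := [set node3].
Definition B_II : {set 'I_3} := [set node1].
Definition C_II : {set 'I_3} := [set node2; node3].

(* Main.v *)
Require Import Defs.
From HB Require Import structures.
From mathcomp Require Import all_boot all_order all_algebra.
From mathcomp Require Import all_classical all_reals all_analysis.
From mathcomp Require Import measurable_realfun ring.
Import Order.TTheory GRing.Theory Num.Theory.
Import numFieldNormedType.Exports.

(** In the branch, I - G has the inverse 1 + q^-1 A + q^-2 A^2
    ([invmx_branchE]), so the sensitivity of output j to parameter k is a sum
    over the excited nodes i of a constant S_k(j, i) times r_i delayed by j - i
    ([psi_branchE]).  For a given output each excitation thus enters with a
    single delay, and excitations at distinct nodes are uncorrelated; hence the
    information matrix is, at every time t ([information_mxE]),

      M(k, l) = sum_(j in C) sum_(i in B) S_k(j, i) S_l(j, i) sigma_i^2 / lambda_j.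

    Independence, a product rule on generated sigma-algebras, is turned into
    uncorrelatedness through product measures and Fubini's theorem
    ([expectation_mul_independent]).

    As M is a 2 x 2 matrix, tr M^-1 = tr M / det M, which yields
    ([mxtrace_cov_I], [mxtrace_cov_II])

      tr P^I  = lambda_3 / (a32^2 sigma_1^2)
                + lambda_3 (1 + (a21 / a32)^2) / sigma_2^2,
      tr P^II = lambda_3 / (a21^2 sigma_1^2)
                + lambda_2 (1 + (a32 / a21)^2) / sigma_1^2.

    When a21 = a32 the first terms agree and the second ones are twice the
    inverses of sigma_2^2 / lambda_3 and of sigma_1^2 / lambda_2, so the
    comparison of the traces is that of these two signal-to-noise ratios,
    reversed. *)

Set Implicit Arguments.
Unset Strict Implicit.
Unset Printing Implicit Defensive.

Local Open Scope ring_scope.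

(** * Independence and expectation of products *)

Section Independence.
Context d (T : measurableType d) (R : realType) (P : probability T R).
Local Open Scope classical_set_scope.

Lemma Lfun2_Lfun1 (X : T -> R) : X \in Lfun P 2%:E -> X \in Lfun P 1.
Proof. by move=> X2; apply: Lfun_subset12 => //; exact: fin_num_measure. Qed.

(** By the product rule on rectangles, the law of (X, Y) is the product of the
    laws of X and Y; Fubini's theorem then splits the integral of x * y. *)
Lemma expectation_mul_independent (X Y : {RV P >-> R}) :
  (forall U V : set R, measurable U -> measurable V ->
     P (X @^-1` U `&` Y @^-1` V) = (P (X @^-1` U) * P (Y @^-1` V))%E) ->
  (X : T -> R) \in Lfun P 2%:E -> (Y : T -> R) \in Lfun P 2%:E ->
  ('E_P[(X : T -> R) \* (Y : T -> R)] = 'E_P[X] * 'E_P[Y])%E.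
Proof.
move=> indXY X2 Y2.
have X1 := Lfun2_Lfun1 X2; have Y1 := Lfun2_Lfun1 Y2.
have iX : P.-integrable setT (EFin \o X) by apply/Lfun1_integrable.
have iY : P.-integrable setT (EFin \o Y) by apply/Lfun1_integrable.
have XY1 := Lfun2_mul_Lfun1 X2 Y2.
pose XY x := (X x, Y x).
have mXY : measurable_fun setT XY by apply: measurable_fun_pair.
pose f (z : R * R) : \bar R := (z.1 * z.2)%:E.
have mf : measurable_fun [set: R * R] f.
  by apply/measurable_EFinP; apply: measurable_funM.
have prodE A : measurable A ->
    (distribution P X \x distribution P Y)%E A = pushforward P XY A.
  apply: (product_measure_unique (m' := pushforward P XY)) => U V mU mV.
  exact: indXY.
have intf : P.-integrable (XY @^-1` setT) (f \o XY).
  by rewrite preimage_setT; apply/Lfun1_integrable.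
rewrite unlock.
transitivity (\int[(distribution P X \x distribution P Y)%E]_z f z)%E.
  rewrite (eq_measure_integral (pushforward P XY)); last first.
    by move=> A mA _; exact: prodE.
  by rewrite integral_pushforward.
rewrite -integral12_prod_meas1; last first.
  have /integrableP[_ f_fin] := integrable_pushforward mXY mf intf measurableT.
  apply/integrableP; split => //.
  by rewrite (eq_measure_integral (pushforward P XY)) // => A mA _; exact: prodE.
have finY : (\int[P]_x (Y x)%:E)%E \is a fin_num by exact: integrable_fin_num.
transitivity (\int[distribution P X]_x (x%:E * \int[P]_w (Y w)%:E))%E.
  apply: eq_integral => x _; rewrite /fubini_F.
  under eq_integral do rewrite /f /= EFinM.
  rewrite integralZl//; last first.
    by apply: (@integrable_pushforward _ _ _ _ R (Y : T -> R) _ P setT (@EFin R)).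
  by rewrite integral_distribution.
rewrite -(fineK finY) integral_distribution/=.
- by rewrite integralZr.
- exact/measurable_EFinP/measurable_funM.
- exact: integrableZr.
Qed.
End Independence.

(** * Inverses and traces of matrices *)

Lemma invmx_unique (K : comUnitRingType) n (A B : 'M[K]_n) :
  A *m B = 1%:M -> invmx A = B.
Proof.
move=> AB; have [uA _] := mulmx1_unit AB.
by rewrite -[B](mulKmx uA) AB mulmx1.
Qed.

Lemma mxtrace_invmx2 (K : fieldType) (M : 'M[K]_2) :
  \det M != 0 -> \tr (invmx M) = \tr M / \det M.
Proof.
move=> M0; have -> : invmx M = (\det M)^-1 *: \adj M.
  by rewrite /invmx unitmxE unitfE M0.
rewrite mxtraceZ mulrC; congr (_ / _).
rewrite /mxtrace !big_ord_recl !big_ord0 !mxE /cofactor !det_mx11 !mxE /=.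
rewrite !addr0 !expr2 ?expr0 ?mul1r ?mulrNN ?mulr1 addrC mul1r.
by congr (M _ _ + M _ _); exact: val_inj.
Qed.

Lemma det2 (K : comNzRingType) (M : 'M[K]_2) : \det M = M 0 0 * M 1 1 - M 0 1 * M 1 0.
Proof.
rewrite (expand_det_row _ 0) !big_ord_recl big_ord0 /cofactor !det_mx11 !mxE /=.
rewrite addr0 expr0 expr1 mul1r mulN1r mulrN.
by congr (M _ _ * M _ _ - M _ _ * M _ _); exact: val_inj.
Qed.

(** * Polynomials in the delay and affine derivatives *)

Lemma delayed_monomial (K : idomainType) (c : K) (m : nat) (u : nat -> K) :
  \sum_(k < size (c *: 'X^m : {poly K})) (c *: 'X^m)`_k * u k = c * u m.
Proof.
have [->|c0] := eqVneq c 0; first by rewrite scale0r size_poly0 big_ord0 mul0r.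
rewrite size_scale// size_polyXn big_ord_recr /= big1 ?add0r.
  by rewrite coefZ coefXn eqxx mulr1.
by move=> k _; rewrite coefZ coefXn ltn_eqF// mulr0 mul0r.
Qed.

(** The difference quotient along v is constant. *)
Lemma derive_affine (R : realType) (V : normedModType R) (f : V -> R)
    (a v : V) (c : R) :
  (forall h, f (h *: v + a) = f a + h * c) -> 'D_v f a = c.
Proof.
move=> fE; apply: lim_near_cst => //; near=> h => /=.
rewrite fE addrC addKr [_ *: _]mulrA mulVf ?mul1r//.
near: h; exact: nbhs_dnbhs_neq.
Unshelve. all: by end_near. Qed.

(** * The transfer matrix of the branch *)

Section BranchTransfer.
Variable R : realType.

(** The delays in (I - G)^-1 are forced by the path lengths, so its entries are
    monomials; this matrix collects their coefficients. *)
Definition branch_gain (theta : 'rV[R]_2) : 'M[R]_3 :=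
  1%:M + branch_coef theta + branch_coef theta *m branch_coef theta.

Lemma branch_coef_sqr (theta : 'rV[R]_2) :
  branch_coef theta *m branch_coef theta
  = (theta 0 0 * theta 0 1) *: delta_mx node3 node1.
Proof.
rewrite /branch_coef !(mulmxDl, mulmxDr) -!scalemxAl -!scalemxAr.
rewrite !mul_delta_mx_cond /= !mulr0n !scaler0 !addr0 !add0r mulr1n.
by rewrite scalerA mulrC.
Qed.

Lemma branch_coef_cube (theta : 'rV[R]_2) :
  branch_coef theta *m (branch_coef theta *m branch_coef theta) = 0.
Proof.
rewrite branch_coef_sqr -scalemxAr /branch_coef mulmxDl -!scalemxAl.
by rewrite !mul_delta_mx_cond /= !mulr0n !scaler0 addr0 scaler0.
Qed.

(** The Neumann series of (I - G)^-1 stops at G^2 because the longest path has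
    two edges, and the only path from i to j has j - i edges.  For j < i the
    difference j - i is truncated to 0, harmlessly since the gain vanishes. *)
Lemma invmx_branchE (theta : 'rV[R]_2) (j i : 'I_3) :
  invmx (1%:M - branch theta) j i = branch_gain theta j i *: 'X^(j - i).
Proof.
set H := \matrix_(j, i) (branch_gain theta j i *: 'X^(j - i)) : 'M[{poly R}]_3.
have HE : H = 1%:M + branch theta + branch theta *m branch theta.
  rewrite /branch -scalemxAl -scalemxAr scalerA -expr2 -map_mxM /=.
  rewrite /H /branch_gain branch_coef_sqr.
  apply/matrixP => {}j {}i; rewrite !mxE /=.
  case: j => [[|[|[|//]]] hj]; case: i => [[|[|[|//]]] hi];
    rewrite /= ?(mulr0, mulr1, addr0, add0r, scale0r, scale1r, polyC0, subnn, expr0) //;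
    by rewrite -mul_polyC mulrC.
have BH : (1%:M - branch theta) *m H = 1%:M.
  rewrite HE.
  have B3 : branch theta *m (branch theta *m branch theta) = 0.
    rewrite /branch -!(scalemxAl, scalemxAr) -!map_mxM /=.
    by rewrite branch_coef_cube map_mx0 !scaler0.
  rewrite mulmxBl !mulmxDr !mul1mx !mulmx1 B3 addr0.
  by rewrite -(addrA 1%:M) addrK.
by rewrite (invmx_unique BH) mxE.
Qed.
End BranchTransfer.

(** * Second moments of the excitations *)

Section Moments.
Context d (T : measurableType d) (R : realType) (P : probability T R).

(** Integrability is part of the notion: the expectation of a function that is
    not integrable is a junk value, and additivity fails for it. *)
Definition has_mean (f : T -> R) (m : R) :=
  f \in Lfun P 1 /\ ('E_P[f] = m%:E)%E.

Lemma has_meanZ (c : R) f m : has_mean f m -> has_mean (fun x => c * f x) (c * m).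
Proof.
move=> [f1 fm]; have -> : (fun x => c * f x) = c \o* f.
  by apply/funext => x; rewrite /= mulrC.
by split; [exact: Lfun_scale | rewrite expectationZl// fm].
Qed.

Lemma has_mean_sum (I : finType) (A : {pred I}) (f : I -> T -> R) (m : I -> R) :
  (forall i, i \in A -> has_mean (f i) (m i)) ->
  has_mean (fun x => \sum_(i in A) f i x) (\sum_(i in A) m i).
Proof.
move=> fm; have -> : (fun x => \sum_(i in A) f i x) = \sum_(i in A) f i.
  by apply/funext => x; rewrite fct_sumE.
apply: (big_rec2 has_mean) => [|i m' f' Ai [f'1 f'm]].
  by split; [exact: Lfun_cst | exact: expectation_cst].
have [fi1 fim] := fm i Ai.
by split; [exact: rpredD | rewrite expectationD// fim f'm].
Qed.

Lemma has_mean_bilinear (I : finType) (A : {set I}) (u : I -> T -> R)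
    (v a b : I -> R) :
  (forall i j, i \in A -> j \in A ->
     has_mean (fun x => u i x * u j x) (if i == j then v i else 0)) ->
  has_mean (fun x => (\sum_(i in A) a i * u i x) * (\sum_(i in A) b i * u i x))
    (\sum_(i in A) a i * b i * v i).
Proof.
move=> uv.
have -> : (fun x => (\sum_(i in A) a i * u i x) * (\sum_(i in A) b i * u i x))
   = (fun x => \sum_(i in A) \sum_(j in A) a i * b j * (u i x * u j x)).
  apply/funext => x; rewrite mulr_suml; apply: eq_bigr => i _.
  by rewrite mulr_sumr; apply: eq_bigr => j _; rewrite mulrACA.
have -> : \sum_(i in A) a i * b i * v i
   = \sum_(i in A) \sum_(j in A) a i * b j * (if i == j then v i else 0).
  apply: eq_bigr => i Ai; rewrite (bigD1 i)//= eqxx big1 ?addr0// => j /andP[_ ji].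
  by rewrite eq_sym (negPf ji) mulr0.
apply: has_mean_sum => i Ai; apply: has_mean_sum => j Aj.
by apply: has_meanZ; exact: uv.
Qed.

Local Open Scope classical_set_scope.

(** Of the family of events in [independent_processes], only those at i and j
    are proper; every other one is the whole space, of probability 1. *)
Lemma independent_processes_pair n (A : {set 'I_n}) (X : 'I_n -> int -> {RV P >-> R})
    (i j : 'I_n) (t u : int) (U V : set R) :
  independent_processes A X -> i \in A -> j \in A -> i != j ->
  measurable U -> measurable V ->
  P (X i t @^-1` U `&` X j u @^-1` V) = (P (X i t @^-1` U) * P (X j u @^-1` V))%E.
Proof.
move=> indX Ai Aj ij mU mV.
pose F k := if k == i then X i t @^-1` U else if k == j then X j u @^-1` V else setT.
have Fi : F i = X i t @^-1` U by rewrite /F eqxx.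
have Fj : F j = X j u @^-1` V by rewrite /F eq_sym (negPf ij) eqxx.
have sF k : k \in A -> process_sigma (X k) (F k).
  move=> _; apply: sub_gen_smallest; rewrite /F /=.
  have [->|ki] := eqVneq k i; first by exists t, U.
  have [->|kj] := eqVneq k j; first by exists u, V.
  by exists 0, setT; rewrite ?preimage_setT.
have := indX F sF.
rewrite (bigD1 i)//= (bigD1 j) /=; last by rewrite Aj eq_sym.
rewrite big1 ?mule1; last first.
  by move=> k /andP[/andP[_ ki] kj]; rewrite /F (negPf ki) (negPf kj) probability_setT.
rewrite Fi Fj => <-; congr (P _); apply/seteqP; split => x /=.
  move=> [Ux Vx] k _; rewrite /F.
  by have [_//|_] := eqVneq k i; have [_//|_] := eqVneq k j.
by move=> Fx; have := Fx i Ai; have := Fx j Aj; rewrite Fi Fj.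
Qed.

(** The lag [tau i] depends on the node alone, so the diagonal case i = j only
    involves the variance of [X i]. *)
Lemma excitation_moments n (A : {set 'I_n}) (X : 'I_n -> int -> {RV P >-> R})
    (v : 'I_n -> R) (tau : 'I_n -> int) (i j : 'I_n) :
  independent_processes A X -> (forall k, k \in A -> white_noise (X k) (v k)) ->
  i \in A -> j \in A ->
  has_mean (fun x => X i (tau i) x * X j (tau j) x) (if i == j then v i else 0).
Proof.
move=> indX wX Ai Aj.
have [[Xi2 _ _] Xi0 Xiv _] := wX i Ai; have [[Xj2 _ _] Xj0 _ _] := wX j Aj.
split; first exact: Lfun2_mul_Lfun1.
have [ij|ij] := eqVneq i j.
  rewrite -ij -(Xiv (tau i)) varianceE// Xi0 expe2 mul0e sube0.
  by congr expectation; apply/funext => x; rewrite /= expr2.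
rewrite (expectation_mul_independent (X := X i (tau i)) (Y := X j (tau j)))//.
  by rewrite Xi0 mul0e.
by move=> U V mU mV; exact: independent_processes_pair indX Ai Aj ij mU mV.
Qed.
End Moments.

(** * The information matrix *)

Section Information.
Context d (T : measurableType d) (R : realType) (P : probability T R).
Variables (n p : nat) (B C : {set 'I_n}) (G : 'rV[R]_p -> 'M[{poly R}]_n).

(** The delay may depend on the output, but for a fixed output j each
    excitation occurs once; the cross terms of the product of two
    sensitivities of the same output therefore have zero mean. *)
Lemma information_mxE (sigma lambda : 'I_n -> R) (D : signals P C)
    (theta : 'rV[R]_p) (t : int) (S : 'I_p -> 'M[R]_n) (delay : 'I_n -> 'I_n -> nat)
    (k l : 'I_p) :
  signal_assumptions B sigma lambda D ->
  (forall j, j \in C -> lambda j != 0) ->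
  (forall x k j, psi B G theta D t x k j =
     \sum_(i in B) S k (enum_val j) i * exc D i (t - (delay (enum_val j) i)%:Z) x) ->
  information_mx B G lambda theta D t k l =
  \sum_(j in C) (lambda j)^-1 * \sum_(i in B) S k j i * S l j i * sigma i ^+ 2.
Proof.
move=> [wB indB _ _ _] lam0 psiE; rewrite mxE.
have invL : invmx (Lambda C lambda) = diag_mx (\row_j (lambda (enum_val j))^-1).
  have LK : Lambda C lambda *m diag_mx (\row_j (lambda (enum_val j))^-1) = 1%:M.
    rewrite mulmx_diag -diag_const_mx; congr diag_mx.
    by apply/rowP => j; rewrite !mxE divff// lam0// enum_valP.
  exact: invmx_unique.
pose w (m : 'I_p) (j : 'I_n) x :=
  \sum_(i in B) S m j i * exc D i (t - (delay j i)%:Z) x.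
have -> : (fun x => (psi B G theta D t x *m invmx (Lambda C lambda) *m
    (psi B G theta D t x)^T) k l) =
  (fun x => \sum_(j in C) (lambda j)^-1 * (w k j x * w l j x)).
  apply/funext => x; rewrite invL mul_mx_diag mxE [RHS]big_enum_val.
  by apply: eq_bigr => j _; rewrite mxE [_^T _ _]mxE !psiE mxE mulrAC mulrC.
have [_ ->] : has_mean P (fun x => \sum_(j in C) (lambda j)^-1 * (w k j x * w l j x))
   (\sum_(j in C) (lambda j)^-1 * \sum_(i in B) S k j i * S l j i * sigma i ^+ 2).
  apply: has_mean_sum => j _; apply: has_meanZ; apply: has_mean_bilinear => i i' Bi Bi'.
  exact: (excitation_moments (fun i => t - (delay j i)%:Z) indB wB).
by [].
Qed.

Lemma selection_mulmxE (N : 'M[{poly R}]_n) (j : 'I_#|C|) (l : 'I_#|B|) :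
  (map_mx polyC (measurement_mx C) *m N *m map_mx polyC (excitation_mx B)) j l
  = N (enum_val j) (enum_val l).
Proof.
rewrite mxE (bigD1 (enum_val l))//= big1 ?addr0 => [|i il]; last first.
  by rewrite !mxE (negPf il) polyC0 mulr0.
rewrite !mxE eqxx mulr1 (bigD1 (enum_val j))//= big1 ?addr0 => [|i ij]; last first.
  by rewrite !mxE (negPf ij) polyC0 mul0r.
by rewrite !mxE eqxx mul1r.
Qed.
End Information.

(** * Sensitivities of the predictor of the branch *)

Section BranchSensitivity.
Context d (T : measurableType d) (R : realType) (P : probability T R).

(** The partial derivative of [branch_gain] in the k-th parameter. *)
Definition branch_sens (theta : 'rV[R]_2) (k : 'I_2) : 'M[R]_3 :=
  (if k == 0 then delta_mx node2 node1 + theta 0 1 *: delta_mx node3 node1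
   else delta_mx node3 node2 + theta 0 0 *: delta_mx node3 node1).

(** The product of the two parameters is the only nonlinear entry of the gain;
    it is affine along each coordinate direction. *)
Lemma branch_gain_affine (theta : 'rV[R]_2) (k : 'I_2) (h : R) :
  branch_gain (h *: delta_mx 0 k + theta)
  = branch_gain theta + h *: branch_sens theta k.
Proof.
rewrite /branch_gain !branch_coef_sqr /branch_coef /branch_sens.
case: k => [[|[|//]] hk].
all: apply/matrixP => j i; rewrite !mxE /=; ring.
Qed.

Variables (B C : {set 'I_3}) (D : signals P C) (t : int).

Lemma predictor_branchE (theta : 'rV[R]_2) x j :
  predictor B branch D t x theta j 0 =
  \sum_(i in B) branch_gain theta (enum_val j) i *
    exc D i (t - (enum_val j - i)%N%:Z) x.
Proof.
rewrite mxE [RHS]big_enum_val; apply: eq_bigr => l _.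
rewrite selection_mulmxE invmx_branchE.
rewrite (delayed_monomial _ _ (fun k => exc_vec B (exc D) (t - k%:Z) x l 0)).
by rewrite [exc_vec _ _ _ _ _ _]mxE.
Qed.

Lemma psi_branchE (theta : 'rV[R]_2) x k j :
  psi B branch theta D t x k j =
  \sum_(i in B) branch_sens theta k (enum_val j) i *
    exc D i (t - (enum_val j - i)%N%:Z) x.
Proof.
rewrite mxE; apply: derive_affine => h.
rewrite !predictor_branchE mulr_sumr -big_split /=; apply: eq_bigr => i _.
by rewrite branch_gain_affine !mxE mulrDl mulrA.
Qed.
End BranchSensitivity.

(** * Traces of the asymptotic covariance matrices *)

Section Traces.
Context d (T : measurableType d) (R : realType) (P : probability T R).
Variables (a21 a32 : R) (sigma lambda : 'I_3 -> R) (t : int).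
Hypotheses (a21_neq0 : a21 != 0) (a32_neq0 : a32 != 0).
Hypothesis sigma1_gt0 : 0 < sigma node1 ^+ 2.
Hypothesis lambda3_gt0 : 0 < lambda node3.

Lemma information_branchE (B C : {set 'I_3}) (D : signals P C) (k l : 'I_2) :
  signal_assumptions B sigma lambda D ->
  (forall j, j \in C -> lambda j != 0) ->
  information_mx B branch lambda (branch_param a21 a32) D t k l =
  \sum_(j in C) (lambda j)^-1 * \sum_(i in B)
    branch_sens (branch_param a21 a32) k j i *
    branch_sens (branch_param a21 a32) l j i * sigma i ^+ 2.
Proof.
move=> hD lam0.
rewrite (information_mxE (G := branch) (delay := fun j i => (j - i)%N)
  (S := branch_sens (branch_param a21 a32)) k l hD lam0) // => x m j.
exact: psi_branchE.
Qed.

Lemma mxtrace_cov_I (D : signals P C_I) :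
  0 < sigma node2 ^+ 2 -> signal_assumptions B_I sigma lambda D ->
  \tr (asymptotic_cov B_I branch lambda (branch_param a21 a32) D t) =
  lambda node3 * ((a32 ^+ 2 * sigma node1 ^+ 2)^-1
                  + (1 + (a21 / a32) ^+ 2) / sigma node2 ^+ 2).
Proof.
move=> sigma2_gt0 hD.
have lam0 j : j \in C_I -> lambda j != 0 by rewrite inE => /eqP ->; rewrite gt_eqF.
have n12 : node1 \notin [set node2] by rewrite inE.
have ME k l := information_branchE k l hD lam0.
have s10 : sigma node1 != 0 by rewrite -sqrf_eq0 gt_eqF.
have s20 : sigma node2 != 0 by rewrite -sqrf_eq0 gt_eqF.
have l30 : lambda node3 != 0 by rewrite gt_eqF.
have trE : \tr (information_mx B_I branch lambda (branch_param a21 a32) D t) =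
  (lambda node3)^-1 *
  (a32 ^+ 2 * sigma node1 ^+ 2 + a21 ^+ 2 * sigma node1 ^+ 2 + sigma node2 ^+ 2).
  rewrite /mxtrace !big_ord_recl big_ord0 !ME.
  rewrite /B_I /C_I !big_set1 !big_setU1// !big_set1 /branch_sens /= !mxE /=.
  by ring.
have detE : \det (information_mx B_I branch lambda (branch_param a21 a32) D t) =
  (lambda node3)^-1 ^+ 2 * (a32 ^+ 2 * sigma node1 ^+ 2 * sigma node2 ^+ 2).
  rewrite det2 !ME.
  rewrite /B_I /C_I !big_set1 !big_setU1// !big_set1 /branch_sens /= !mxE /=.
  by ring.
rewrite /asymptotic_cov mxtrace_invmx2 detE ?trE.
  by field; rewrite s10 s20 l30 a32_neq0.
by rewrite !mulf_neq0 ?expf_neq0 ?invr_neq0 ?expf_neq0.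
Qed.

Lemma mxtrace_cov_II (D : signals P C_II) :
  0 < lambda node2 -> signal_assumptions B_II sigma lambda D ->
  \tr (asymptotic_cov B_II branch lambda (branch_param a21 a32) D t) =
  lambda node3 / (a21 ^+ 2 * sigma node1 ^+ 2)
  + lambda node2 * (1 + (a32 / a21) ^+ 2) / sigma node1 ^+ 2.
Proof.
move=> lambda2_gt0 hD.
have lam0 j : j \in C_II -> lambda j != 0.
  by rewrite !inE => /orP[] /eqP ->; rewrite gt_eqF.
have n23 : node2 \notin [set node3] by rewrite inE.
have ME k l := information_branchE k l hD lam0.
have s10 : sigma node1 != 0 by rewrite -sqrf_eq0 gt_eqF.
have l20 : lambda node2 != 0 by rewrite gt_eqF.
have l30 : lambda node3 != 0 by rewrite gt_eqF.
have trE : \tr (information_mx B_II branch lambda (branch_param a21 a32) D t) =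
  sigma node1 ^+ 2 *
  ((lambda node2)^-1 + (a32 ^+ 2 + a21 ^+ 2) / lambda node3).
  rewrite /mxtrace !big_ord_recl big_ord0 !ME.
  rewrite /B_II /C_II !big_setU1// !big_set1 /branch_sens /= !mxE /=.
  by ring.
have detE : \det (information_mx B_II branch lambda (branch_param a21 a32) D t) =
  (lambda node2 * lambda node3)^-1 * (a21 ^+ 2 * sigma node1 ^+ 4).
  rewrite det2 !ME.
  rewrite /B_II /C_II !big_setU1// !big_set1 /branch_sens /= !mxE /= invfM.
  by ring.
rewrite /asymptotic_cov mxtrace_invmx2 detE ?trE.
  by field; rewrite s10 l20 l30 a21_neq0.
by rewrite !mulf_neq0 ?expf_neq0 ?invr_neq0 ?mulf_neq0.
Qed.
End Traces.

Theorem mainTheorem3 (R : realType)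
  (dI : measure_display) (TI : measurableType dI) (PI : probability TI R)
  (dII : measure_display) (TII : measurableType dII) (PII : probability TII R)
  (a21 a32 : R) (sigma lambda : 'I_3 -> R)
  (DI : signals PI C_I) (DII : signals PII C_II) (tI tII : int)
  (ha21 : a21 != 0) (ha32 : a32 != 0) (ha : a21 = a32)
  (hsigma1 : 0 < sigma node1 ^+ 2) (hsigma2 : 0 < sigma node2 ^+ 2)
  (hlambda2 : 0 < lambda node2) (hlambda3 : 0 < lambda node3)
  (hnetI : dynamic_network B_I (branch (branch_param a21 a32)) DI)
  (hnetII : dynamic_network B_II (branch (branch_param a21 a32)) DII)
  (hsigI : signal_assumptions B_I sigma lambda DI)
  (hsigII : signal_assumptions B_II sigma lambda DII) :
  let covI := asymptotic_cov B_I branch lambda (branch_param a21 a32) DI tI in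
  let covII := asymptotic_cov B_II branch lambda (branch_param a21 a32) DII tII in
  [/\ sigma node2 ^+ 2 = lambda node3 / lambda node2 * sigma node1 ^+ 2 ->
        \tr covI = \tr covII,
      sigma node2 ^+ 2 / lambda node3 > sigma node1 ^+ 2 / lambda node2 ->
        \tr covI < \tr covII &
      sigma node2 ^+ 2 / lambda node3 < sigma node1 ^+ 2 / lambda node2 ->
        \tr covI > \tr covII].
Proof.
move=> covI covII; rewrite {}/covI {}/covII ha.
have s10 : sigma node1 != 0 by rewrite -sqrf_eq0 gt_eqF.
have s20 : sigma node2 != 0 by rewrite -sqrf_eq0 gt_eqF.
have l20 : lambda node2 != 0 by rewrite gt_eqF.
have l30 : lambda node3 != 0 by rewrite gt_eqF.
have snrI : 0 < sigma node2 ^+ 2 / lambda node3 by exact: divr_gt0.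
have snrII : 0 < sigma node1 ^+ 2 / lambda node2 by exact: divr_gt0.
have -> : \tr (asymptotic_cov B_I branch lambda (branch_param a32 a32) DI tI)
    = lambda node3 / (a32 ^+ 2 * sigma node1 ^+ 2)
      + 2 * (sigma node2 ^+ 2 / lambda node3)^-1.
  rewrite (mxtrace_cov_I _ _ ha32 hsigma1 hlambda3 hsigma2 hsigI).
  by field; rewrite s10 s20 l30 ha32.
have -> : \tr (asymptotic_cov B_II branch lambda (branch_param a32 a32) DII tII)
    = lambda node3 / (a32 ^+ 2 * sigma node1 ^+ 2)
      + 2 * (sigma node1 ^+ 2 / lambda node2)^-1.
  rewrite (mxtrace_cov_II _ _ ha32 hsigma1 hlambda3 hlambda2 hsigII).
  by field; rewrite s10 l20 ha32.
split => [->|lt|lt].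
- by field; rewrite s10 l20 l30 ha32.
- by rewrite ltrD2l ltr_pM2l// ltf_pV2.
- by rewrite ltrD2l ltr_pM2l// ltf_pV2.
Qed.
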